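(* Let $q(u)=\sqrt{u(1-u)\log\log(1/(u(1-u)))}$, $0<u<1$, let $\alpha\in(0,1)$, and let $t^+_\alpha(q)$ be the critical value satisfying $\mathbf{P}\left(\sup_{0<u<1}B(u)/q(u)\geq t^+_\alpha(q)\right)=\alpha$, where $\{B(u),0\leq u\leq 1\}$ is a Brownian bridge. For $Y_1,\ldots,Y_n$ independent identically distributed with values in $[0,1]$ and $\mathbb{G}_n(u)=n^{-1}\sum_{i=1}^n\mathbb{I}(Y_i\leq u)$, let $$T_n^+(q)=\sup_{0<u<1}\frac{\sqrt{n}\,(\mathbb{G}_n(u)-u)}{q(u)},$$ and consider the test of asymptotic level $\alpha$ that rejects the null hypothesis $\mathcal{H}_0$ (the $Y_i$ are uniform on $(0,1)$) when $T_n^+(q)\geq t^+_\alpha(q)$. Let $\beta\in(1/2,1)$ and $r\in(0,1)$ satisfy $r>\rho(\beta)$, where $$\rho(\beta)=\begin{cases}\beta-1/2, & 1/2<\beta<3/4,\\ (1-\sqrt{1-\beta})^2, & 3/4\leq\beta<1,\end{cases}$$ and put $\varepsilon_n=n^{-\beta}$, $\mu_n=\sqrt{2r\log n}$. Let $\mathcal{H}_{1,n}$ be the alternative under which $Y_1,\ldots,Y_n$ are independent identically distributed with common cumulative distribution function $$\mathcal{G}(u)=u+\varepsilon_n\left((1-u)-\Phi\left(\Phi^{-1}(1-u)-\mu_n\right)\right),\qquad 0<u<1.$$ Then the test has full power against $\mathcal{H}_{1,n}$, that is, $$\mathbf{P}_{\mathcal{H}_{1,n}}\left(T_n^+(q)\geq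 t^+_\alpha(q)\right)\to 1,\qquad n\to\infty.$$
   Context: $\Phi$ is the standard normal cumulative distribution function, $\log$ is the natural logarithm, $\mathbb{I}(A)$ is the indicator of $A$. The observations arise as $Y_i=1-\Phi(X_i)$, where under $\mathcal{H}_0$ the $X_1,\ldots,X_n$ are independent $N(0,1)$, and under $\mathcal{H}_{1,n}$ the $X_1,\ldots,X_n$ are independent with the mixture distribution $(1-\varepsilon_n)N(0,1)+\varepsilon_n N(\mu_n,1)$; $\mathbf{P}_{\mathcal{H}_{1,n}}$ denotes probability under $\mathcal{H}_{1,n}$. *)

(* Defs.v *)
From HB Require Import structures.
From mathcomp Require Import all_boot all_order all_algebra.
From mathcomp Require Import all_classical all_reals all_analysis.

Set Implicit Arguments.
Unset Strict Implicit.
Unset Printing Implicit Defensive.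

Import Order.TTheory GRing.Theory Num.Theory.
Import numFieldNormedType.Exports.

Local Open Scope classical_set_scope.
Local Open Scope ring_scope.

Definition Phi {R : realType} (x : R) : R := fine (normal_prob 0 1 `]-oo, x]).

(* [Phi] is a bijection from R onto ]0, 1[, so for p in ]0, 1[ this is the
   unique x with Phi x = p; the default value 0 is only used off ]0, 1[. *)
Definition Phi_inv {R : realType} (p : R) : R := xget 0 [set x | Phi x = p].

Definition q_weight {R : realType} (u : R) : R :=
  Num.sqrt (u * (1 - u) * ln (ln (1 / (u * (1 - u))))).

Definition rho {R : realType} (beta : R) : R :=
  if beta < 3 / 4 then beta - 1 / 2 else (1 - Num.sqrt (1 - beta)) ^+ 2.

Section random_variables.
Context d (T : measurableType d) (R : realType) (P : probability T R).

(* Degenerate (constant) Gaussians are allowed. They are treated separately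
   because [normal_prob m 0] is a dummy value (uniform on [0, 1]) in the
   library, not the Dirac mass at m. *)
Definition gaussian (X : T -> R) : Prop :=
  exists m s : R, 0 <= s /\ forall A : set R, measurable A ->
    P (X @^-1` A) = if s == 0 then \d_m A else normal_prob m s A.

(* Only the indices u in [0, 1] matter: the bridge {B(u), 0 <= u <= 1} is
   represented by a family indexed by R, unconstrained off [0, 1]. *)
Definition brownian_bridge (B : R -> {RV P >-> R}) : Prop :=
  [/\ forall w : T, {within `[0, 1], continuous (fun u => B u w)},
      forall (k : nat) (a t : 'I_k -> R), (forall i, t i \in `[0, 1]) ->
        gaussian (fun w => \sum_(i < k) a i * B (t i) w),
      forall u, u \in `[0, 1] -> ('E_P[B u] = 0)%E &
      forall u v, u \in `[0, 1] -> v \in `[0, 1] ->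
        covariance P (B u) (B v) = (Num.min u v - u * v)%:E].

Definition sup_bridge (B : R -> {RV P >-> R}) (q : R -> R) (w : T) : \bar R :=
  ereal_sup [set (B u w / q u)%:E | u in `]0, 1[].

Definition critical_value (B : R -> {RV P >-> R}) (q : R -> R) (alpha t : R) :
    Prop :=
  P [set w | (t%:E <= sup_bridge B q w)%E] = alpha%:E.

Definition independent_RVs (n : nat) (Y : 'I_n -> {RV P >-> R}) : Prop :=
  forall (J : {set 'I_n}) (A : 'I_n -> set R), (forall i, measurable (A i)) ->
    P (\bigcap_(i in [set` J]) (Y i @^-1` A i)) =
    (\prod_(i in J) P (Y i @^-1` A i))%E.

(* For [0, 1]-valued variables, prescribing the distribution function on
   ]0, 1[ determines the law. *)
Definition iid_unit_cdf (n : nat) (Y : 'I_n -> {RV P >-> R}) (G : R -> R) :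
    Prop :=
  [/\ independent_RVs Y,
      forall i w, Y i w \in `[0, 1] &
      forall i u, u \in `]0, 1[ -> cdf (Y i) u = (G u)%:E].

End random_variables.

Definition empirical_cdf {R : realType} (n : nat) (y : 'I_n -> R) (u : R) : R :=
  n%:R^-1 * \sum_(i < n) (y i <= u)%R%:R.

Definition T_plus {R : realType} (q : R -> R) (n : nat) (y : 'I_n -> R) :
    \bar R :=
  ereal_sup [set (Num.sqrt n%:R * (empirical_cdf y u - u) / q u)%:E
            | u in `]0, 1[].

Definition alternative_cdf {R : realType} (eps mu u : R) : R :=
  u + eps * ((1 - u) - Phi (Phi_inv (1 - u) - mu)).

(* Main.v *)
(* Evaluate the statistic at the single point u = P(N(0,1) > z), where
   z = a sqrt(2 ln n), with a = 2 sqrt r if beta < 3/4 and r < 1/4, and a = 1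
   otherwise.  Up to factors exp(O(sqrt(ln n))), one has u <= n^(-a^2) and
   delta := G(u) - u >= n^(-beta - (a - sqrt r)^2), and the condition
   rho(beta) < r is exactly what makes both n delta^2 / u and n delta positive
   powers of n.  The log-log factor of q costs only an arbitrarily small power of
   u, so Chebyshev's inequality for the number of Y_i below u bounds the
   probability of not rejecting by O(u / (n delta^2) + 1 / (n delta)). *)
Require Import Defs.
From HB Require Import structures.
From mathcomp Require Import all_boot all_order all_algebra.
From mathcomp Require Import all_classical all_reals all_analysis.
From mathcomp Require Import measurable_realfun ring lra.

Import Order.TTheory GRing.Theory Num.Theory.
Import numFieldNormedType.Exports.

Local Open Scope classical_set_scope.
Local Open Scope ring_scope.

(** * The standard normal distribution function *)

Lemma normal_pdf_sd1E (R : realType) (m x : R) :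
  normal_pdf m 1 x = normal_peak 1 * expR (- (x - m) ^+ 2 / 2).
Proof. by rewrite normal_pdfE ?oner_neq0// /normal_fun expr1n. Qed.

Lemma normal_prob_fin (R : realType) (A : set R) : measurable A ->
  normal_prob 0 1 A \is a fin_num.
Proof.
by move=> mA; exact: (fin_num_measure (normal_prob (0 : R) 1)).
Qed.

Lemma PhiE (R : realType) (x : R) : (Phi x)%:E = normal_prob 0 1 `]-oo, x].
Proof. by rewrite /Phi fineK// normal_prob_fin. Qed.

Lemma PhiB (R : realType) (x y : R) : x <= y ->
  (Phi y - Phi x)%:E = normal_prob 0 1 `]x, y].
Proof.
move=> xy; rewrite EFinB !PhiE.
rewrite (_ : `]-oo, y]%classic = `]-oo, x]%classic `|` `]x, y]%classic).
  rewrite measureU//=; last first.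
    by rewrite -subset0 => z [] /=; rewrite !in_itv/= => zx /andP[]; rewrite ltNge zx.
  by rewrite addeAC subee ?add0e// normal_prob_fin.
by rewrite -itv_bndbnd_setU.
Qed.

Lemma Phi_tailE (R : realType) (x : R) :
  (1 - Phi x)%:E = normal_prob 0 1 `]x, +oo[.
Proof.
rewrite EFinB PhiE -(probability_setT (normal_prob (0 : R) 1)).
rewrite -(setUv `]-oo, x]%classic) measureU//=; last 2 first.
- exact: measurableC.
- exact: setICr.
by rewrite addeAC subee ?add0e ?normal_prob_fin// setCitvl.
Qed.

Lemma Phi_incr_ge (R : realType) (x y c : R) : x <= y ->
  (forall v, x < v <= y -> c <= normal_pdf 0 1 v) -> 0 <= c ->
  c * (y - x) <= Phi y - Phi x.
Proof.
move=> xy hc c0; rewrite -lee_fin PhiB// /normal_prob.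
have -> : (c * (y - x))%:E = (\int[lebesgue_measure]_(v in `]x, y]) c%:E)%E.
  rewrite integral_cst//= lebesgue_measure_itv/= lte_fin.
  have [xy'|] := ltP x y; first by rewrite -EFinB -EFinM.
  by move=> yx; rewrite (_ : y = x) ?subrr ?mulr0 ?mule0//; apply/le_anti/andP.
apply: ge0_le_integral => //=.
by apply/measurable_EFinP; apply: measurable_funTS; exact: measurable_normal_pdf.
Qed.

Lemma Phi_lt (R : realType) (x y : R) : x < y -> Phi x < Phi y.
Proof.
move=> xy; rewrite -subr_gt0.
(* Any [v] in []x, y]] satisfies [v^2 <= x^2 + y^2], whatever the signs, so [c] bounds the density
   from below there. *)
set c := normal_peak 1 * expR (- (x ^+ 2 + y ^+ 2) / 2).
have c0 : 0 < c by rewrite mulr_gt0 ?expR_gt0 ?normal_peak_gt0.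
apply: (@lt_le_trans _ _ (c * (y - x))); first by rewrite mulr_gt0 ?subr_gt0.
apply: Phi_incr_ge; [exact: ltW| |exact: ltW].
move=> v /andP[xv vy]; rewrite normal_pdf_sd1E subr0.
rewrite ler_wpM2l ?normal_peak_ge0// ler_expR.
have [v0|v0] := leP 0 v; nra.
Qed.

Lemma Phi_gt0 (R : realType) (x : R) : 0 < Phi x.
Proof.
rewrite (@le_lt_trans _ _ (Phi (x - 1)))//; last by apply: Phi_lt; lra.
by rewrite -lee_fin PhiE measure_ge0.
Qed.

Lemma Phi_lt1 (R : realType) (x : R) : Phi x < 1.
Proof.
rewrite (@lt_le_trans _ _ (Phi (x + 1)))//; first by apply: Phi_lt; lra.
by rewrite -lee_fin PhiE; exact: (@probability_le1 _ _ _ (normal_prob (0 : R) 1)).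
Qed.

(** Injectivity of [Phi] suffices here: the statistic is evaluated at points of the form
    [1 - Phi z], so [Phi_inv] is only met at values of [Phi]. *)
Lemma Phi_invK (R : realType) (x : R) : Phi_inv (Phi x) = x.
Proof.
rewrite /Phi_inv; case: xgetP => [y _ /= |/(_ x)/(_ erefl)//].
by move=> e; case: (ltgtP y x) => // /Phi_lt; rewrite e ltxx.
Qed.

(* On [z <= v] we have [v^2 >= z^2 + (v - z)^2], so the density is dominated by
   [expR (- z^2 / 2)] times the density recentred at [z]. *)
Lemma Phi_tail_le (R : realType) (z : R) : 0 <= z ->
  1 - Phi z <= expR (- z ^+ 2 / 2).
Proof.
move=> z0; rewrite -lee_fin Phi_tailE /normal_prob.
have mp m : measurable_fun `]z, +oo[%classic
    (fun v : measurableTypeR R => (normal_pdf m 1 v)%:E).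
  apply/measurable_EFinP; apply: measurable_funTS.
  exact: measurable_normal_pdf.
apply: (@le_trans _ _ (\int[lebesgue_measure]_(v in `]z, +oo[)
    ((expR (- z ^+ 2 / 2))%:E * (normal_pdf z 1 v)%:E))%E).
  apply: ge0_le_integral => //=.
  - by move=> v _; rewrite lee_fin normal_pdf_ge0.
  - exact: mp.
  - by apply: measurable_funeM; exact: mp.
  - move=> v; rewrite in_itv/= andbT => zv.
    rewrite -EFinM lee_fin !normal_pdf_sd1E mulrCA ler_wpM2l ?normal_peak_ge0//.
    by rewrite -expRD ler_expR subr0; nra.
rewrite ge0_integralZl//=; last 2 first.
- exact: mp.
- by move=> v _; rewrite lee_fin normal_pdf_ge0.
rewrite -[leRHS]mule1; apply: lee_wpmul2l; first by rewrite lee_fin expR_ge0.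
exact: (@probability_le1 _ _ _ (normal_prob z 1)).
Qed.

(** Only the mass of []x, x + 1]] is kept, where the density is at least its value at [x + 1].
    Having [x + 1] in place of [x] costs a factor exp(O(x + 1)), negligible against powers of n. *)
Lemma Phi_diff_ge (R : realType) (x z : R) : 0 <= x -> x + 1 <= z ->
  normal_peak 1 * expR (- (x + 1) ^+ 2 / 2) <= Phi z - Phi x.
Proof.
move=> x0 xz; apply: (@le_trans _ _ (Phi (x + 1) - Phi x)); last first.
  rewrite lerB//; move: xz; rewrite le_eqVlt => /predU1P[->//|/Phi_lt/ltW//].
set c := leLHS; have -> : c = c * (x + 1 - x) by ring.
apply: Phi_incr_ge; first by lra.
- move=> v /andP[xv vx]; rewrite normal_pdf_sd1E subr0.
  by rewrite ler_wpM2l ?normal_peak_ge0// ler_expR; nra.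
- by rewrite mulr_ge0 ?normal_peak_ge0 ?expR_ge0.
Qed.

(** * Chebyshev's inequality for pairwise independent events *)

Lemma measurable_superlevel d (T : measurableType d) (R : realType)
    (f : T -> R) (c : R) :
  measurable_fun setT f -> measurable [set w | c <= f w].
Proof.
move=> mf; have := mf measurableT `[c, +oo[%classic (measurable_itv _).
rewrite setTI (_ : _ @^-1` _ = [set w | c <= f w])//.
by apply/seteqP; split=> w /=; rewrite in_itv/= andbT.
Qed.

Lemma variance_sum_uncorrelated d (T : measurableType d) (R : realType)
    (P : probability T R) (I : eqType) (X : I -> T -> R) (s : seq I) :
  uniq s -> (forall i, X i \in Lfun P 2%:E) ->
  (forall i j, i != j -> covariance P (X i) (X j) = 0%E) ->
  'V_P[\sum_(i <- s) X i] = \sum_(i <- s) 'V_P[X i]%E.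
Proof.
move=> + X2 X0.
have S2 (t : seq I) : (\sum_(i <- t) X i)%R \in Lfun P 2%:E.
  by elim/big_ind: _ => // [|f g]; [exact: Lfun_cst|apply: rpredD; rewrite ?lee1n].
have cov0 i (t : seq I) : i \notin t ->
    covariance P (X i) (\sum_(j <- t) X j)%R = 0%E.
  elim: t => [|j t ih]; first by rewrite big_nil covariance_cst_r.
  rewrite inE negb_or => /andP[ij it].
  by rewrite big_cons covarianceDr// X0// add0e ih.
elim: s => [|i s ih /= /andP[si us]]; first by rewrite !big_nil variance_cst.
by rewrite !big_cons varianceD// ih// cov0// mule0 adde0.
Qed.

(** The number of events that occur has mean np and, by pairwise independence, variance at most np,
    since an indicator has variance p - p^2. The lower deviation is contained in the two-sided
    one. *)
Lemma chebyshev_indep_events d (T : measurableType d) (R : realType)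
    (P : probability T R) (n : nat) (A : 'I_n -> set T) (p lam : R) :
  (forall i, measurable (A i)) -> (forall i, P (A i) = p%:E) ->
  (forall i j, i != j -> P (A i `&` A j) = (p * p)%:E) -> 0 < lam ->
  (P [set w | lam <= n%:R * p - \sum_(i < n) \1_(A i) w]%R
    <= (n%:R * p / lam ^+ 2)%:E)%E.
Proof.
move=> mA PA PAA lam0.
pose X i : T -> R := \1_(A i).
have X2 i : X i \in Lfun P 2%:E.
  rewrite inE; apply/andP; split; rewrite inE/=; first exact: measurable_indic.
  rewrite /finite_norm unlock poweR_lty//.
  (* An indicator equals its own square, so its second moment is the finite number [P (A i)]. *)
  rewrite (eq_integral (fun x => (\1_(A i) x)%:E)) => [|x _].
    by rewrite integral_indic// setIT (le_lt_trans (probability_le1 _ _)) ?ltry.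
  rewrite /X/= indicE; case: (x \in A i); rewrite ?normr1 ?powR1//.
  by rewrite normr0 powR0.
have X1 i : X i \in Lfun P 1.
  exact: (Lfun_subset12 (fin_num_measure P _ measurableT)).
have EX i : ('E_P[X i] = p%:E)%E by rewrite expectation_indic.
have XX i j : (X i * X j)%R = \1_(A i `&` A j) by rewrite indicI.
have covX i j : i != j -> covariance P (X i) (X j) = 0%E.
  move=> ij; rewrite covarianceE ?Lfun2_mul_Lfun1// !EX XX.
  by rewrite expectation_indic ?PAA ?EFinM ?subee//; exact: measurableI.
have VX i : ('V_P[X i] <= p%:E)%E.
  rewrite varianceE// EX expr2 XX setIid expectation_indic// PA.
  by rewrite -EFin_expe -EFinB lee_fin lerBlDr lerDl sqr_ge0.
have mS : measurable_fun setT (\sum_(i < n) X i)%R.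
  rewrite (_ : (\sum_(i < n) X i)%R = fun w => \sum_(i < n) X i w)%R; last first.
    by apply/funext => w; rewrite fct_sumE.
  apply: measurable_sum => i; exact: measurable_indic.
pose S : {RV P >-> R} := HB.pack (\sum_(i < n) X i)%R (isMeasurableFun.Build _ _ _ _ _ mS).
have ES : ('E_P[S] = (n%:R * p)%:E)%E.
  have := @expectation_sum _ _ _ P [seq X i | i <- index_enum 'I_n].
  rewrite !big_map => ->; last by move=> _ /mapP[i _ ->].
  under eq_bigr do rewrite EX.
  by rewrite sumEFin sumr_const card_ord mulr_natl.
have VS : ('V_P[S] <= (n%:R * p)%:E)%E.
  rewrite variance_sum_uncorrelated ?index_enum_uniq//.
  apply: (@le_trans _ _ (\sum_(i < n) p%:E)%E); first exact: lee_sum.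
  by rewrite sumEFin sumr_const card_ord mulr_natl.
have := @chebyshev _ _ _ P S lam lam0; rewrite ES /= => cheb.
apply: (@le_trans _ _ (P [set w | lam <= `|S w - n%:R * p|]%R))%E; last first.
  apply: (le_trans cheb); rewrite mulrC EFinM.
  by apply: lee_wpmul2l => //; rewrite lee_fin invr_ge0 exprn_ge0// ltW.
have Sw w : S w = \sum_(i < n) \1_(A i) w by rewrite /S/= fct_sumE.
apply: le_measure; rewrite ?inE.
- rewrite (_ : mkset _ = [set w | lam <= n%:R * p - S w]); last first.
    by apply/seteqP; split=> w; rewrite /mkset Sw.
  by apply: measurable_superlevel; exact: measurable_funB.
- apply: measurable_superlevel; apply: measurableT_comp => //.
  exact: measurable_funB.
- by move=> w; rewrite /mkset Sw distrC => h; apply: (le_trans h); exact: ler_norm.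
Qed.

(** * The weight function and the measurability of the statistic *)

(** This is e < 4: the bound 1 + x <= e^x at x = -1/4 gives 1/e >= (3/4)^4 = 81/256 > 1/4. Since u(1
    - u) <= 1/4, it makes the iterated logarithm in [q_weight] positive. *)
Lemma ln4_gt1 (R : realType) : 1 < ln (4 : R).
Proof.
have h : 3 / 4 <= expR (- (1 / 4)) :> R.
  by rewrite (le_trans _ (expR_ge1Dx _))//; lra.
have e4 : expR 1 * expR (- (1 / 4)) ^+ 4 = 1 :> R.
  by rewrite -expRM_natl -expRD (_ : 1 + _ = 0) ?expR0//; lra.
rewrite -[ltLHS]expRK ltr_ln ?posrE ?expR_gt0// ltNge; apply/negP => e1.
have h2 : (3 / 4) ^+ 4 <= expR (- (1 / 4)) ^+ 4 :> R by rewrite lerXn2r ?nnegrE ?expR_ge0//; lra.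
have : (4 : R) * (3 / 4) ^+ 4 <= expR 1 * expR (- (1 / 4)) ^+ 4.
  exact: ler_pM.
by rewrite e4; lra.
Qed.

Lemma inv_unit_prod_ge4 (R : realType) (u : R) : 0 < u < 1 ->
  4 <= 1 / (u * (1 - u)).
Proof.
move=> /andP[u0 u1]; have h : 0 < u * (1 - u) by nra.
by rewrite ler_pdivlMr//; have := sqr_ge0 (1 - 2 * u); nra.
Qed.

Lemma lnln_gt0 (R : realType) (u : R) : 0 < u < 1 ->
  0 < ln (ln (1 / (u * (1 - u)))).
Proof.
move=> u01; rewrite ln_gt0// (lt_le_trans (ln4_gt1 R))// ler_ln ?posrE//.
  exact: inv_unit_prod_ge4.
by rewrite (lt_le_trans _ (inv_unit_prod_ge4 _ _ u01)).
Qed.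

Lemma q_weight_gt0 (R : realType) (u : R) : 0 < u < 1 -> 0 < q_weight u.
Proof.
move=> u01; rewrite sqrtr_gt0 mulr_gt0 ?lnln_gt0//.
by case/andP: u01 => *; nra.
Qed.

Lemma q_weight_continuous (R : realType) (u : R) : 0 < u < 1 ->
  {for u, continuous (@q_weight R)}.
Proof.
move=> u01; have h4 := inv_unit_prod_ge4 _ _ u01; have h1 := ln4_gt1 R.
have p0 : 0 < u * (1 - u) by case/andP: u01 => *; nra.
have cp : (fun v : R => v * (1 - v)) @ u --> u * (1 - u).
  by apply: cvgM; [exact: cvg_id|apply: cvgB; [exact: cvg_cst|exact: cvg_id]].
have ci : (fun v : R => 1 / (v * (1 - v))) @ u --> 1 / (u * (1 - u)).
  by apply: cvgM; [exact: cvg_cst|apply: cvgV; rewrite ?gt_eqF].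
have cl : (fun v : R => ln (1 / (v * (1 - v)))) @ u --> ln (1 / (u * (1 - u))).
  by apply: (cvg_comp _ _ ci); apply: continuous_ln; lra.
have cll : (fun v : R => ln (ln (1 / (v * (1 - v))))) @ u -->
    ln (ln (1 / (u * (1 - u)))).
  apply: (cvg_comp _ _ cl); apply: continuous_ln.
  by rewrite (lt_trans _ (lt_le_trans h1 _))// ler_ln ?posrE//; lra.
by apply: (cvg_comp _ _ (cvgM cp cll)); exact: sqrt_continuous.
Qed.

Lemma empirical_cdf_homo (R : realType) (n : nat) (y : 'I_n -> R) (u v : R) :
  u <= v -> empirical_cdf y u <= empirical_cdf y v.
Proof.
move=> uv; rewrite ler_wpM2l ?invr_ge0// ler_sum// => i _.
by rewrite ler_nat; case: (leP (y i) u) => // /le_trans/(_ uv) ->.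
Qed.

(* The empirical process only jumps upwards, so just to the right of a point it
   stays above any level it strictly exceeds there. *)
Lemma T_plus_gt_rat (R : realType) (n : nat) (y : 'I_n -> R) (c : R) :
  (c%:E < T_plus q_weight y)%E <->
  exists q : rat, (0 < (ratr q : R) < 1) /\
    c * q_weight (ratr q) < Num.sqrt n%:R * (empirical_cdf y (ratr q) - ratr q).
Proof.
split; last first.
  move=> [q [q01 h]]; apply: lt_le_trans (ereal_sup_ubound _); last first.
    by exists (ratr q); [rewrite /= in_itv|].
  by rewrite lte_fin ltr_pdivlMr// q_weight_gt0.
move=> /ereal_sup_gt[_ [u /= +] <-]; rewrite in_itv/= => u01.
rewrite lte_fin ltr_pdivlMr ?q_weight_gt0// => cu.
pose g v := Num.sqrt n%:R * (empirical_cdf y u - v) - c * q_weight v.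
have gc : {for u, continuous g}.
  apply: cvgB; apply: cvgM; [exact: cvg_cst| |exact: cvg_cst|exact: q_weight_continuous].
  by apply: cvgB; [exact: cvg_cst|exact: cvg_id].
have : \forall v \near u, 0 < g v /\ v < 1.
  near=> v; split.
    by near: v; apply: (cvgr_gt _ gc); rewrite subr_gt0.
  by near: v; apply: lt_nbhsl; case/andP: u01.
move=> /nbhs_ballP[e /= e0 he].
have ue : u < u + e by lra.
have [q /=] := rat_in_itvoo ue.
rewrite in_itv/= => /andP[uq qe].
have [] := he (ratr q); first by rewrite /ball/= ltr0_norm; lra.
rewrite subr_gt0 => gq q1; exists q; split; first by case/andP: u01; lra.
apply: (lt_le_trans gq); rewrite ler_wpM2l// lerB// empirical_cdf_homo// ltW.
Unshelve. all: by end_near. Qed.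

(** The supremum is over uncountably many points, but T >= c means T > c - 1/(k+1) for every k, and
    each strict inequality is witnessed at a rational point. *)
Lemma measurable_T_plus_ge d (T : measurableType d) (R : realType)
    (P : probability T R) (n : nat) (Y : 'I_n -> {RV P >-> R}) (c : R) :
  measurable [set w | (c%:E <= T_plus q_weight (fun i => Y i w))%E].
Proof.
pose A (k : nat) (q : rat) := if 0 < (ratr q : R) < 1 then
  [set w | (c - k.+1%:R^-1) * q_weight (ratr q) <
    Num.sqrt n%:R * (empirical_cdf (fun i => Y i w) (ratr q) - ratr q)] else set0.
rewrite (_ : mkset _ = \bigcap_k \bigcup_q A k q); last first.
  apply/seteqP; split=> w /=.
    move=> cw k _.
    have : ((c - k.+1%:R^-1)%:E < T_plus q_weight (fun i => Y i w))%E.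
      by apply: lt_le_trans cw; rewrite lte_fin ltrBlDr ltrDl invr_gt0.
    by move=> /T_plus_gt_rat[q [q01 h]]; exists q => //; rewrite /A q01.
  move=> h; apply/lee_subgt0Pr => e e0.
  (* With this [k], k + 1 > 1/e, hence 1/(k+1) < e. *)
  pose k := Num.truncn e^-1.
  have [q _] := h k I; rewrite /A; case: ifP => // q01 hq.
  apply: ltW; apply: (@le_lt_trans _ _ (c - k.+1%:R^-1)%:E).
    rewrite -EFinB lee_fin lerB// invf_ple ?posrE//.
    by rewrite ltW// truncnS_gt.
  by apply/T_plus_gt_rat; exists q.
apply: bigcapT_measurable => k; apply: bigcupT_measurable_rat => q.
rewrite /A; case: ifP => // _.
pose f w := Num.sqrt n%:R * (empirical_cdf (fun i => Y i w) (ratr q) - ratr q).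
have mf : measurable_fun setT f.
  apply: measurable_funM => //; apply: measurable_funB => //.
  apply: measurable_funM => //; apply: measurable_sum => i.
  rewrite (_ : (fun _ => _) = \1_(Y i @^-1` `]-oo, ratr q])).
    by apply: measurable_indic; exact: (measurable_funPTI (Y i)).
  apply/funext => w; rewrite indicE/=; congr ((nat_of_bool _)%:R).
  by apply/idP/idP; rewrite inE/= in_itv/=.
have := mf measurableT `](c - k.+1%:R^-1) * q_weight (ratr q), +oo[%classic
  (measurable_itv _).
rewrite setTI (_ : _ @^-1` _ = [set w | (c - k.+1%:R^-1) * q_weight (ratr q) < f w])//.
by apply/seteqP; split=> w /=; rewrite in_itv/= andbT.
Qed.

(** Write p = u(1 - u) <= u. Then log log(1/p) <= log(1/p), and k log(1/p) <= p^(-k) because x <=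
    e^x: the log-log factor costs an arbitrarily small power. *)
Lemma q_weight_sqr_le (R : realType) (u k : R) : 0 < u < 1 -> 0 < k < 1 ->
  q_weight u ^+ 2 <= u `^ (1 - k) / k.
Proof.
move=> u01 k01; have [u0 u1] := andP u01; have [k0 k1] := andP k01.
set p := u * (1 - u); have p0 : 0 < p by rewrite /p; nra.
rewrite sqr_sqrtr; last by rewrite !mulr_ge0 ?ltW ?lnln_gt0//; lra.
have l0 : 0 < ln (1 / p).
  by rewrite ln_gt0//; have := inv_unit_prod_ge4 _ _ u01; rewrite -/p; lra.
apply: (@le_trans _ _ (p * ln (1 / p))).
  by apply: ler_wpM2l; apply: ltW => //; exact: ln_sublinear.
apply: (@le_trans _ _ (p `^ (1 - k) / k)); last first.
  apply: ler_wpM2r; first by rewrite invr_ge0 ltW.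
  by apply: ge0_ler_powR; rewrite ?nnegrE /p; nra.
rewrite ler_pdivlMr// /powR gt_eqF// div1r lnV ?posrE//.
rewrite -{1}(@lnK _ p) ?posrE// mulrDl mul1r expRD -mulrA ler_wpM2l ?expR_ge0//.
rewrite [leRHS](_ : _ = expR (k * - ln p)); last by congr expR; lra.
by apply: le_trans (expR_ge1Dx _); lra.
Qed.

(** * Power of the test *)

(** Once M >= 1 and eM >= |K| + |C| + 1, the exponent is at most -M. *)
Lemma expR_quadratic_cvg (R : realType) (e K C : R) : 0 < e ->
  expR (- e * M ^+ 2 + K * M + C) @[M --> +oo] --> (0 : R).
Proof.
move=> e0.
apply: (@squeeze_cvgr _ _ _ _ (fun=> 0) (fun M => expR (- M))); last 2 first.
- exact: cvg_cst.
- exact: cvgr_expR.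
near=> M; rewrite expR_ge0/= ler_expR.
have M1 : 1 <= M by near: M; exact: nbhs_pinfty_ge.
have : `|K| + `|C| + 1 <= e * M.
  rewrite -ler_pdivrMl//; near: M; exact: nbhs_pinfty_ge.
have := ler_norm K; have := ler_norm C.
have := normr_ge0 C; nra.
Unshelve. all: by end_near. Qed.

Lemma sqrt_ln_cvg (R : realType) :
  Num.sqrt (ln n%:R) @[n --> \oo] --> (+oo : set_system R).
Proof.
apply/cvgryPge => A; near=> n.
have An : expR (A ^+ 2) <= n%:R :> R.
  by near: n; exact: nbhs_infty_ger.
have n0 : 0 < n%:R :> R by rewrite (lt_le_trans _ An)// expR_gt0.
rewrite (le_trans (ler_norm A))// -sqrtr_sqr ler_wsqrtr//.
by rewrite -ler_expR lnK.
Unshelve. all: by end_near. Qed.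

(** [a] fixes the evaluation point and [k] is the power given up to the log-log factor. The first
    inequality is strict, so it suffices to find [a] for k = 0 and then take [k] small. *)
Lemma detection_exponents (R : realType) (beta r : R) :
  1 / 2 < beta < 1 -> 0 < r < 1 -> rho beta < r ->
  exists a k : R, [/\ Num.sqrt r < a, 0 < k < 1,
    0 < a ^+ 2 * (1 - k) + 1 - 2 * beta - 2 * (a - Num.sqrt r) ^+ 2 &
    0 < 1 - beta - (a - Num.sqrt r) ^+ 2].
Proof.
move=> /andP[b1 b2] /andP[r0 r1]; set b := Num.sqrt r => hrho.
have b0 : 0 < b by rewrite sqrtr_gt0.
have bb : b ^+ 2 = r by rewrite sqr_sqrtr// ltW.
have bl1 : b < 1 by rewrite -(@ltr_pXn2r _ 2)// ?nnegrE ?ltW// bb expr1n.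
suff [a [ab a1 a2]] : exists a : R, [/\ b < a,
    0 < a ^+ 2 + 1 - 2 * beta - 2 * (a - b) ^+ 2 & 0 < 1 - beta - (a - b) ^+ 2].
  set e := _ + 1 - _ - _ in a1.
  have ae : 0 < a ^+ 2 + e by rewrite addr_gt0// exprn_gt0//; lra.
  (* This [k] satisfies e - a^2 k = e k, which is positive. *)
  exists a, (e / (a ^+ 2 + e)); split => //.
    rewrite divr_gt0//= ltr_pdivrMr// mul1r ltrDr exprn_gt0//; lra.
  have -> : a ^+ 2 * (1 - e / (a ^+ 2 + e)) + 1 - 2 * beta - 2 * (a - b) ^+ 2 =
      e * (e / (a ^+ 2 + e)).
    transitivity (e - a ^+ 2 * (e / (a ^+ 2 + e))); first by rewrite /e; ring.
    by field; rewrite gt_eqF.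
  by rewrite mulr_gt0// divr_gt0.
have [/andP[h1 h2]|h] := boolP ((beta < 3 / 4) && (r < 1 / 4)).
  (* a = 2b maximizes a^2 - 2(a - b)^2, with value 2r; the conditions become r > beta - 1/2 and r <
     1 - beta. *)
  by exists (2 * b); move: hrho; rewrite /rho h1 => ?; split; nra.
(* At a = 1 both conditions reduce to (1 - b)^2 < 1 - beta. For beta < 3/4 this follows from b >=
   1/2, otherwise from b > 1 - sqrt(1 - beta). *)
exists 1; move: hrho h; rewrite /rho; case: (ltP beta (3 / 4)) => /= [h1 h|h1 h _].
  rewrite -leNgt => r4; have : 1 / 2 <= b by nra.
  by move=> ?; split => //; nra.
set s := Num.sqrt (1 - beta); rewrite -/s in h.
have ss : s ^+ 2 = 1 - beta by rewrite sqr_sqrtr//; lra.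
have s0 : 0 <= s := sqrtr_ge0 _.
have sb : 1 - s < b.
  rewrite ltNge; apply/negP => bs; have : 0 <= (1 - s - b) * (1 - s + b) by nra.
  by move: h; nra.
by split => //; nra.
Qed.

(** The supremum dominates its value at [u], whose drift is at least twice the threshold. A failure
    to reject thus forces the count of [Y i <= u] at least n delta / 2 below its mean n G(u), where
    delta = G(u) - u, and Chebyshev's inequality applies. *)
Lemma T_plus_power_ge d (T : measurableType d) (R : realType)
    (P : probability T R) (n : nat) (Y : 'I_n -> {RV P >-> R}) (G : R -> R)
    (u c : R) :
  (0 < n)%N -> iid_unit_cdf Y G -> 0 < u < 1 -> 0 < G u - u ->
  c * q_weight u <= Num.sqrt n%:R * (G u - u) / 2 ->
  ((1 - 4 * G u / (n%:R * (G u - u) ^+ 2))%:E <=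
    P [set w | (c%:E <= T_plus q_weight (fun i => Y i w))%E])%E.
Proof.
move=> n0 [indep _ cdfY] u01 d0 hc; set delta := G u - u in d0 hc *.
have nR : 0 < n%:R :> R by rewrite ltr0n.
have sn : 0 < Num.sqrt n%:R :> R by rewrite sqrtr_gt0.
have u01' : u \in `]0, 1[ by rewrite in_itv.
pose A i := Y i @^-1` `]-oo, u]%classic.
have mA i : measurable (A i) by exact: (measurable_funPTI (Y i)).
have PA i : P (A i) = (G u)%:E by rewrite -(cdfY i u u01').
have PAA i j : i != j -> P (A i `&` A j) = (G u * G u)%:E.
  move=> ij; have := indep [set i; j]%SET (fun=> `]-oo, u]%classic) (fun=> measurable_itv _).
  rewrite EFinM big_setU1 ?inE//= big_set1 -/(A i) -/(A j) !PA => <-.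
  congr (P _); apply/seteqP; split=> w.
    by move=> [Ai Aj] k /=; rewrite !inE => /orP[] /eqP ->.
  by move=> h; split; apply: h; rewrite /= !inE eqxx ?orbT.
pose bad := [set w | n%:R * delta / 2 <= n%:R * G u - \sum_(i < n) \1_(A i) w].
have mbad : measurable bad.
  apply: measurable_superlevel; apply: measurable_funB => //.
  by apply: measurable_sum => i; exact: measurable_indic.
have lam0 : 0 < n%:R * delta / 2 by rewrite divr_gt0// mulr_gt0.
have Pbad := chebyshev_indep_events _ _ _ _ _ _ _ _ mA PA PAA lam0.
apply: (@le_trans _ _ (P (~` bad))).
  rewrite probability_setC// -/bad in Pbad *; rewrite EFinB leeB//.
  apply: (le_trans Pbad); rewrite lee_fin le_eqVlt; apply/orP; left; apply/eqP.
  by field; rewrite !gt_eqF.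
apply: le_measure; rewrite ?inE.
- exact: measurableC.
- exact: measurable_T_plus_ge.
move=> w /= /negP; rewrite -ltNge => hw.
apply: (le_trans _ (ereal_sup_ubound _)); last by exists u.
rewrite lee_fin ler_pdivlMr ?q_weight_gt0// (le_trans hc)//.
have -> : empirical_cdf (fun i => Y i w) u = n%:R^-1 * \sum_(i < n) \1_(A i) w.
  congr (_ * _); apply: eq_bigr => i _; rewrite indicE; congr ((nat_of_bool _)%:R).
  by apply/idP/idP; rewrite inE /A/= in_itv/=.
rewrite -mulrA ler_pM2l// -(ler_pM2l nR) mulrBr mulVKf ?gt_eqF//.
by move: hw; rewrite /delta; lra.
Qed.

(** At u = 1 - Phi z the excess G(u) - u is eps (Phi z - Phi (z - mu)). The bound mu >= 1 leaves
    room for a unit interval to the right of z - mu, and mu <= z puts it on the half-line where the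
    density decreases. *)
Lemma alternative_shift_ge (R : realType) (eps mu z : R) :
  0 <= eps -> 1 <= mu -> mu <= z ->
  eps * (normal_peak 1 * expR (- (z - mu + 1) ^+ 2 / 2)) <=
    alternative_cdf eps mu (1 - Phi z) - (1 - Phi z).
Proof.
move=> e0 m1 mz; rewrite /alternative_cdf subKr Phi_invK [leRHS]addrC addKr.
by rewrite ler_wpM2l// Phi_diff_ge; lra.
Qed.

(** In terms of M = sqrt(ln n), eps is exp(-beta M^2), mu is sqrt 2 b M and z is sqrt 2 a M; the
    exponent is the expanded square (z - mu + 1)^2 / 2. *)
Lemma alternative_gap_ge (R : realType) (beta r a : R) (n : nat) :
  let M := Num.sqrt (ln n%:R) in let b := Num.sqrt r in
  let u := 1 - Phi (Num.sqrt 2 * a * M) in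
  (0 < n)%N -> 0 <= r -> b <= a -> 1 <= Num.sqrt 2 * b * M ->
  normal_peak 1 *
    expR (- (beta + (a - b) ^+ 2) * M ^+ 2 - Num.sqrt 2 * (a - b) * M - 1 / 2) <=
  alternative_cdf (n%:R `^ (- beta)) (Num.sqrt (2 * r * ln n%:R)) u - u.
Proof.
move=> M b u n0 r0 ab mu1.
have n1 : 1 <= n%:R :> R by rewrite ler1n.
have M0 : 0 <= M by exact: sqrtr_ge0.
have MM : M ^+ 2 = ln n%:R by rewrite sqr_sqrtr// ln_ge0.
have nE : n%:R `^ (- beta) = expR (- beta * M ^+ 2) by rewrite /powR gt_eqF ?ltr0n// MM.
have muE : Num.sqrt (2 * r * ln n%:R) = Num.sqrt 2 * b * M.
  by rewrite !sqrtrM ?mulr_ge0.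
have muz : Num.sqrt 2 * b * M <= Num.sqrt 2 * a * M.
  by rewrite ler_wpM2r// ler_wpM2l// sqrtr_ge0.
rewrite muE; apply: le_trans (alternative_shift_ge _ _ _ _ (powR_ge0 _ _) mu1 muz).
rewrite nE [leRHS]mulrCA; apply: ler_wpM2l; first exact: normal_peak_ge0.
rewrite -expRD ler_expR -subr_ge0 [leRHS](_ : _ = 0)//.
have s2 : Num.sqrt 2 ^+ 2 = 2 :> R by rewrite sqr_sqrtr.
set s := Num.sqrt 2 in s2 *.
(* The two exponents differ by a multiple of 1 - s^2/2, which vanishes. *)
transitivity ((a - b) ^+ 2 * M ^+ 2 * (1 - s ^+ 2 / 2)); first by field.
by rewrite s2; field.
Qed.

(* [h1] and [h2] bound [u / (n delta^2)] and [1 / (n delta)], where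
   [u = 1 - Phi (a * sqrt (2 ln n))] and [delta] is the excess of the alternative
   over the uniform distribution function at [u]; [h1] bounds
   [q_weight u ^ 2 / (n delta^2)] as well. *)
Lemma detection_power_ge (R : realType) (beta r a k c : R) (n : nat)
    d (T : measurableType d) (P : probability T R) (Y : 'I_n -> {RV P >-> R}) :
  let M := Num.sqrt (ln n%:R) in let b := Num.sqrt r in
  let K := Num.sqrt 2 * (a - b) in
  let h1 := expR (- (a ^+ 2 * (1 - k) + 1 - 2 * beta - 2 * (a - b) ^+ 2) * M ^+ 2
                  + 2 * K * M + 1) / (k * normal_peak 1 ^+ 2) in
  let h2 := expR (- (1 - beta - (a - b) ^+ 2) * M ^+ 2 + K * M + 1 / 2)
            / normal_peak 1 in
  (0 < n)%N -> 0 < r -> b < a -> 0 < k < 1 -> 1 <= Num.sqrt 2 * b * M ->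
  4 * c ^+ 2 * h1 <= 1 ->
  iid_unit_cdf Y
    (alternative_cdf (n%:R `^ (- beta)) (Num.sqrt (2 * r * ln n%:R))) ->
  ((1 - 4 * (h1 + h2))%:E <=
    P [set w | (c%:E <= T_plus q_weight (fun i => Y i w))%E])%E.
Proof.
move=> M b K h1 h2 n0 r0 ab k01 mu1 ch hY.
have [k0 k1] := andP k01.
have n1 : 1 <= n%:R :> R by rewrite ler1n.
have M0 : 0 <= M by exact: sqrtr_ge0.
have MM : M ^+ 2 = ln n%:R by rewrite sqr_sqrtr// ln_ge0.
have nE : n%:R = expR (M ^+ 2) by rewrite MM lnK// posrE; lra.
have b0 : 0 < b by rewrite sqrtr_gt0.
have c0 : 0 < normal_peak 1 :> R by rewrite normal_peak_gt0.
pose u : R := 1 - Phi (Num.sqrt 2 * a * M).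
have u01 : 0 < u < 1 by rewrite /u; have := Phi_gt0 R (Num.sqrt 2 * a * M);
  have := Phi_lt1 R (Num.sqrt 2 * a * M); lra.
have uM : u <= expR (- a ^+ 2 * M ^+ 2).
  apply: le_trans (Phi_tail_le _ _ _) _; first by rewrite !mulr_ge0 ?sqrtr_ge0//; lra.
  rewrite ler_expR !exprMn sqr_sqrtr//; lra.
(* [V] is n^(-a^2 (1 - k)) / k. It dominates both [u] and the squared weight, so the single quantity
   [h1] controls the variance and the threshold. *)
pose V := expR (- a ^+ 2 * (1 - k) * M ^+ 2) / k.
have uV : u <= V.
  apply: (le_trans uM); rewrite ler_pdivlMr//.
  apply: (@le_trans _ _ (expR (- a ^+ 2 * M ^+ 2))).
    by rewrite ler_piMr ?expR_ge0// ltW.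
  by rewrite ler_expR; have := mulr_ge0 (sqr_ge0 a) (sqr_ge0 M); nra.
have qV : q_weight u ^+ 2 <= V.
  apply: (le_trans (q_weight_sqr_le _ _ _ u01 k01)).
  apply: ler_wpM2r; first by rewrite invr_ge0 ltW.
  have -> : - a ^+ 2 * (1 - k) * M ^+ 2 = - a ^+ 2 * M ^+ 2 * (1 - k) by ring.
  rewrite expRM; apply: ge0_ler_powR; rewrite ?nnegrE ?expR_ge0//; lra.
have gap := alternative_gap_ge _ beta _ _ _ n0 (ltW r0) (ltW ab) mu1.
rewrite -/M -/b -/u in gap.
set G := alternative_cdf _ _ in hY gap *.
set D := _ * expR _ in gap.
have D0 : 0 < D by rewrite mulr_gt0 ?expR_gt0.
have h1E : h1 = V / (n%:R * D ^+ 2).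
  rewrite /h1 /V /D nE; set E1 := expR _; set E2 := expR (_ * M ^+ 2).
  set E3 := expR (_ - _); have -> : E1 = E2 / (expR (M ^+ 2) * E3 ^+ 2).
    by rewrite -expRM_natl -expRD -expRN -expRD; congr expR; rewrite /K; field.
  by field; rewrite !gt_eqF ?expR_gt0.
have h2E : h2 = 1 / (n%:R * D).
  rewrite /h2 /D nE; set E1 := expR _; set E3 := expR (_ - _).
  have -> : E1 = (expR (M ^+ 2) * E3)^-1.
    by rewrite -expRD -expRN; congr expR; rewrite /K; field.
  by field; rewrite !gt_eqF ?expR_gt0.
have n0R : 0 < n%:R :> R by rewrite ltr0n.
have d0 : 0 < G u - u by rewrite (lt_le_trans D0).
have nD : n%:R * D ^+ 2 <= n%:R * (G u - u) ^+ 2.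
  by rewrite ler_pM2l// ler_pXn2r// nnegrE ltW.
have V0 : 0 < V by rewrite divr_gt0 ?expR_gt0.
have q0 := q_weight_gt0 _ _ u01.
apply: le_trans (T_plus_power_ge _ _ _ _ _ _ _ u _ n0 hY u01 d0 _).
  rewrite lee_fin lerB// -mulrA ler_wpM2l//.
  (* Splitting G(u) = u + delta turns G(u) / (n delta^2) into u / (n delta^2) + 1 / (n delta),
     bounded by [h1] and [h2]. *)
  rewrite -{1}(subrK u (G u)) [_ + u]addrC mulrDl lerD//.
    have dV : (n%:R * (G u - u) ^+ 2)^-1 <= (n%:R * D ^+ 2)^-1.
      by rewrite lef_pV2// posrE mulr_gt0// exprn_gt0.
    rewrite h1E; apply: ler_pM => //; first by lra.
    by rewrite invr_ge0 mulr_ge0 ?sqr_ge0.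
  have -> : (G u - u) / (n%:R * (G u - u) ^+ 2) = 1 / (n%:R * (G u - u)).
    by field; rewrite !gt_eqF.
  by rewrite h2E !div1r lef_pV2 ?posrE; [rewrite ler_pM2l|exact: mulr_gt0..].
(* The threshold inequality is proved by squaring, which needs both sides nonnegative; for c <= 0 it
   is immediate from signs. *)
have [c1|c1] := leP c 0.
  rewrite (@le_trans _ _ 0)//; first by rewrite mulr_le0_ge0// ltW.
  by rewrite divr_ge0// mulr_ge0 ?sqrtr_ge0// ltW.
have cq : 0 <= c * q_weight u by rewrite mulr_ge0// ltW.
have sd : 0 <= Num.sqrt n%:R * (G u - u) / 2.
  by rewrite divr_ge0// mulr_ge0 ?sqrtr_ge0// ltW.
rewrite -(@ler_pXn2r _ 2)// exprMn.
have -> : (Num.sqrt n%:R * (G u - u) / 2) ^+ 2 = n%:R * (G u - u) ^+ 2 / 4.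
  by rewrite -[in RHS](sqr_sqrtr (ltW n0R)); field.
apply: (@le_trans _ _ (c ^+ 2 * V)); first by rewrite ler_wpM2l ?sqr_ge0.
have nD0 : 0 < n%:R * D ^+ 2 by apply: mulr_gt0 => //; exact: exprn_gt0.
move: ch; rewrite h1E mulrA ler_pdivrMr// mul1r => ch.
by move: (le_trans ch nD); lra.
Qed.

Theorem theorem4p1 (R : realType)
  (d0 : measure_display) (T0 : measurableType d0) (P0 : probability T0 R)
  (B : R -> {RV P0 >-> R}) (hB : brownian_bridge B)
  (alpha t_alpha : R) (halpha : 0 < alpha < 1)
  (ht : critical_value B q_weight alpha t_alpha)
  (beta r : R) (hbeta : 1 / 2 < beta < 1) (hr : 0 < r < 1)
  (hrho : rho beta < r)
  (d : nat -> measure_display) (T : forall n : nat, measurableType (d n))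
  (P : forall n : nat, probability (T n) R)
  (Y : forall n : nat, 'I_n -> {RV (P n) >-> R})
  (hY : forall n : nat,
     iid_unit_cdf (Y n)
       (alternative_cdf (n%:R `^ (- beta)) (Num.sqrt (2 * r * ln n%:R)))) :
  (fun n : nat =>
     P n [set w | (t_alpha%:E <= T_plus q_weight (fun i => Y n i w))%E])
    @ \oo --> (1 : \bar R)%E.
Proof.
have r0 : 0 < r by case/andP: hr.
have [a [k [ab k01 e1 e2]]] := detection_exponents _ _ _ hbeta hr hrho.
set b := Num.sqrt r in ab e1 e2.
have b0 : 0 < b by rewrite sqrtr_gt0.
pose M n : R := Num.sqrt (ln n%:R).
pose K := Num.sqrt 2 * (a - b).
pose h1 n := expR (- (a ^+ 2 * (1 - k) + 1 - 2 * beta - 2 * (a - b) ^+ 2) * M n ^+ 2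
                + 2 * K * M n + 1) / (k * normal_peak 1 ^+ 2).
pose h2 n := expR (- (1 - beta - (a - b) ^+ 2) * M n ^+ 2 + K * M n + 1 / 2)
          / normal_peak 1.
have quad e K' C : 0 < e ->
    expR (- e * M n ^+ 2 + K' * M n + C) @[n --> \oo] --> (0 : R).
  by move=> e0; exact: (cvg_comp M _ (sqrt_ln_cvg R) (expR_quadratic_cvg R e K' C e0)).
have h1cvg : h1 n @[n --> \oo] --> (0 : R).
  rewrite -[X in _ --> X](mul0r (k * normal_peak 1 ^+ 2)^-1).
  by apply: cvgM; [exact: quad|exact: cvg_cst].
have h2cvg : h2 n @[n --> \oo] --> (0 : R).
  rewrite -[X in _ --> X](mul0r (normal_peak 1)^-1).
  by apply: cvgM; [exact: quad|exact: cvg_cst].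
(* The critical value is a fixed real, so it is eventually absorbed by the decay of [h1]. *)
have small : \forall n \near \oo, 4 * t_alpha ^+ 2 * h1 n <= 1.
  have : (4 * t_alpha ^+ 2 * h1 n) @[n --> \oo] --> 4 * t_alpha ^+ 2 * 0.
    by apply: cvgM; [exact: cvg_cst|exact: h1cvg].
  by rewrite mulr0 => /cvgr_le; apply.
have lb : (1 - 4 * (h1 n + h2 n)) @[n --> \oo] --> (1 : R).
  rewrite -[X in _ --> X](_ : 1 - 4 * (0 + 0) = _); last by ring.
  by apply: cvgB; [exact: cvg_cst|apply: cvgM; [exact: cvg_cst|exact: cvgD]].
apply: (@squeeze_cvge _ _ _ _ (fun n => (1 - 4 * (h1 n + h2 n))%:E) _ (cst 1%E)).
- near=> n; apply/andP; split; last first.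
    by apply: probability_le1; exact: measurable_T_plus_ge.
  apply: (detection_power_ge R beta r a k) => //.
  + by near: n; exact: nbhs_infty_gt.
  (* This condition is mu_n >= 1, true for large n because mu_n tends to infinity. *)
  + rewrite -/b -ler_pdivrMl ?mulr_gt0 ?sqrtr_gt0// mulr1.
    by near: n; move/cvgryPge : (sqrt_ln_cvg R); apply.
  + by near: n.
- by apply: cvg_EFin; [near=> n|exact: lb].
- exact: cvg_cst.
Unshelve. all: by end_near. Qed.
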